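(* Let $(X,\mathcal{A},\mu,\tau,C_\tau)$ be a composition dynamical system on $\mathbb{L}^{\varphi,h}(\mu)$, where in addition $\tau$ is bijective and $\tau^{-1}$ satisfies $\mu(\tau(A))\le M'\mu(A)$ for all $A\in\mathcal{A}$ and some $M'>0$ (so $C_\tau$ is invertible with $C_\tau^{-1}=C_{\tau^{-1}}$), and assume $\varphi$ satisfies the $\Delta_2$-condition. Then $C_\tau$ is uniformly expansive if and only if $\mathcal{A}^+=\{A\in\mathcal{A}:0<\mu(A)<\infty\}$ can be written as $\mathcal{A}^+=\mathcal{A}^+_B\cup\mathcal{A}^+_C$ such that $$\lim_{n\to\infty}\frac{\varphi^{-1}\!\left(\frac{1}{\int_0^{\mu(A)}h(t)\,dt}\right)}{\varphi^{-1}\!\left(\frac{1}{\int_0^{\mu(\tau^{n}(A))}h(t)\,dt}\right)}=\infty \text{ uniformly on } \mathcal{A}^+_B,$$ and $$\lim_{n\to\infty}\frac{\varphi^{-1}\!\left(\frac{1}{\int_0^{\mu(A)}h(t)\,dt}\right)}{\varphi^{-1}\!\left(\frac{1}{\int_0^{\mu(\tau^{-n}(A))}h(t)\,dt}\right)}=\infty \text{ uniformly on } \mathcal{A}^+_C.$$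
   Context: Let $(X,\mathcal{A},\mu)$ be a measure space. For a measurable $g$, its distribution function is $\mu_g(\lambda)=\mu\{x:|g(x)|>\lambda\}$ and its non-increasing rearrangement is $g^*(t)=\inf\{\lambda>0:\mu_g(\lambda)\le t\}$. An Orlicz function is a convex $\varphi:[0,\infty)\to[0,\infty)$ with $\varphi(0)=0$ and $\varphi(s)\to\infty$ as $s\to\infty$; here $\varphi$ is assumed continuous and strictly increasing, and $\varphi^{-1}$ denotes its inverse. $\varphi$ satisfies the $\Delta_2$-condition if there is $K>0$ with $\varphi(2s)\le K\varphi(s)$ for all $s>0$. A weight is a locally integrable, non-increasing function $h:[0,\mu(X))\to(0,\infty)$. The Orlicz–Lorentz space is $\mathbb{L}^{\varphi,h}(\mu)=\{g \text{ measurable}: I_{\varphi,h}(\lambda g)<\infty \text{ for some }\lambda>0\}$ with $I_{\varphi,h}(g)=\int_0^{\mu(X)}\varphi(g^*(t))h(t)\,dt$, normed by $\|g\|_{\varphi,h}=\inf\{\lambda>0: I_{\varphi,h}(g/\lambda)\le 1\}$ (functions equal a.e. identified). For $A\in\mathcal{A}$ with $0<\mu(A)<\infty$ one has $\|\chi_A\|_{\varphi,h}=1/\varphi^{-1}\big(1/\int_0^{\mu(A)}h(t)\,dt\big)$. A composition dynamical system $(X,\mathcal{A},\mu,\tau,C_\tau)$ means: $(X,\mathcal{A},\mu)$ is $\sigma$-finite; $\tau:X\to X$ is injective and bi-measurable; there is $M>0$ with $\mu(\tau^{-1}(A))\le M\mu(A)$ for all $A\in\mathcal{A}$; and $C_\tau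 g=g\circ\tau$ is the (bounded) composition operator on $\mathbb{L}^{\varphi,h}(\mu)$. An invertible bounded operator $T$ on a Banach space $Y$ with unit sphere $S_Y$ is uniformly expansive if there is $n\in\mathbb{N}$ such that for every $y\in S_Y$, $\|T^n y\|\ge2$ or $\|T^{-n}y\|\ge2$ (equivalently, $S_Y=B\cup C$ with $\|T^n y\|\to\infty$ uniformly on $B$ and $\|T^{-n}y\|\to\infty$ uniformly on $C$ as $n\to\infty$). *)

(* Defs.v *)
From HB Require Import structures.
From mathcomp Require Import all_boot all_order all_algebra.
From mathcomp Require Import all_classical all_reals all_analysis.
Set Implicit Arguments. Unset Strict Implicit. Unset Printing Implicit Defensive.
Import Order.TTheory GRing.Theory Num.Theory.
Import numFieldNormedType.Exports.
Local Open Scope classical_set_scope.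
Local Open Scope ring_scope.

Section OrliczLorentz.
Context {R : realType} {d : measure_display} {X : measurableType d}.
Variable mu : {measure set X -> \bar R}.

Definition distrib (g : X -> R) (l : R) : \bar R :=
  mu [set x | l < `|g x|].

(* non-increasing rearrangement g^*(t) = inf {l > 0 : mu_g(l) <= t}
   (value +oo when the set is empty) *)
Definition rearr (g : X -> R) (t : R) : \bar R :=
  ereal_inf [set (l%:E)%E | l in [set l : R | 0 < l /\ (distrib g l <= t%:E)%E]].

Definition phiE (phi : R -> R) (x : \bar R) : \bar R :=
  match x with
  | x%:E => (phi x)%:E
  | +oo%E => +oo%E
  | -oo%E => 0%E
  end.

Definition domw : set R := [set t | 0 <= t /\ (t%:E < mu setT)%E].

Definition Imod (phi h : R -> R) (g : X -> R) : \bar R :=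
  (\int[lebesgue_measure]_(t in domw) (phiE phi (rearr g t) * (h t)%:E))%E.

Definition inOL (phi h : R -> R) (g : X -> R) : Prop :=
  measurable_fun setT g /\ exists l : R, 0 < l /\ (Imod phi h (fun x => (l * g x)%R) < +oo)%E.

Definition OLnorm (phi h : R -> R) (g : X -> R) : \bar R :=
  ereal_inf [set (l%:E)%E | l in
     [set l : R | 0 < l /\ (Imod phi h (fun x => (g x / l)%R) <= 1)%E]].

End OrliczLorentz.

Definition orlicz_function {R : realType} (phi : R -> R) : Prop :=
  [/\ (forall x y t : R, 0 <= x -> 0 <= y -> 0 <= t <= 1 ->
         phi (t * x + (1 - t) * y) <= t * phi x + (1 - t) * phi y),
      phi 0 = 0,
      {within `[0, +oo[%classic, continuous phi},
      (forall x y : R, 0 <= x -> x < y -> phi x < phi y) &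
      phi x @[x --> +oo] --> +oo].

Definition is_orlicz_inverse {R : realType} (phi phi_inv : R -> R) : Prop :=
  (forall s : R, 0 <= s -> phi_inv (phi s) = s) /\
  (forall y : R, 0 <= y -> 0 <= phi_inv y /\ phi (phi_inv y) = y).

Definition Delta2 {R : realType} (phi : R -> R) : Prop :=
  exists K : R, 0 < K /\ forall s : R, 0 < s -> phi (2 * s) <= K * phi s.

Definition weight {R : realType} (muX : \bar R) (h : R -> R) : Prop :=
  [/\ (forall t, 0 <= t -> (t%:E < muX)%E -> 0 < h t),
      (forall s t, 0 <= s -> s <= t -> (t%:E < muX)%E -> h t <= h s) &
      (forall b, 0 <= b -> (b%:E < muX)%E ->
         lebesgue_measure.-integrable `[0, b]%classic (EFin \o h))].

Definition Wint {R : realType} (h : R -> R) (s : R) : R :=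
  Rintegral lebesgue_measure `[0, s[%classic h.

(* phi^{-1}(1 / \int_0^{mu A} h) = 1 / ||chi_A||_{phi,h} *)
Definition fundOL {R : realType} {d : measure_display} {X : measurableType d}
  (mu : {measure set X -> \bar R}) (phi_inv h : R -> R) (A : set X) : R :=
  phi_inv (1 / Wint h (fine (mu A))).

Definition uniformly_expansive_comp {R : realType} {d : measure_display}
  {X : measurableType d} (mu : {measure set X -> \bar R}) (phi h : R -> R)
  (tau tau' : X -> X) : Prop :=
  exists n : nat, forall g : X -> R, inOL mu phi h g -> OLnorm mu phi h g = 1%E ->
    (2%:E <= OLnorm mu phi h (g \o iter n tau))%E \/
    (2%:E <= OLnorm mu phi h (g \o iter n tau'))%E.

(* Main.v *)
Require Import Defs.
From HB Require Import structures.
From mathcomp Require Import all_boot all_order all_algebra.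
From mathcomp Require Import all_classical all_reals all_analysis.
From mathcomp Require Import measurable_realfun ring lra.
Import Order.TTheory GRing.Theory Num.Theory.
Import numFieldNormedType.Exports.
Local Open Scope classical_set_scope.
Local Open Scope ring_scope.

(** Write [W x] for the integral of [h] over [0, x[.  The modular has the layer
cake form: it is the integral over [u >= 0] of [W (mu {|g| > phi^-1 u})], so it
only sees the superlevel sets of [g], and composition with [tau] acts on these
by preimages.

If [C_tau] is uniformly expansive with exponent [n], then testing on normalized
indicators shows that [fundOL] is at least halved at every set along [tau^n] or
along [tau^-n].  A set where it is halved in one direction has an image which
cannot be halved backwards, so the halving propagates and is uniform.

Conversely, uniform growth of the fundamental quotients gives
[K W(mu E) <= W(mu (tau^n E)) + W(mu (tau^-n E))] for every measurable [E].
Integrating over the superlevel sets of [g], one of the two modulars of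
[g o tau^n] and [g o tau^-n] is at least [K/2] times that of [g], and the
[Delta_2] condition turns this into the bound on norms. *)

(** * Measurability of monotone functions and lengths of intervals *)

(** On an interval, the preimage of an upper ray under a nonincreasing function is again an
    interval. *)
Lemma nonincreasing_emeasurable {R : realType} (D : set R) (f : R -> \bar R) :
  is_interval D -> (forall x y, D x -> D y -> x <= y -> (f y <= f x)%E) ->
  measurable_fun D f.
Proof.
move=> iD nf mD; apply: (measurability _ (ErealGenOInfty.measurableE R)) => //.
move=> _ [_ [r ->] <-]; apply: is_interval_measurable => x y /=.
rewrite !in_itv/= !andbT => -[Dx rx] [Dy ry] z /andP[xz zy].
have Dz : D z by apply: (iD x y) => //; rewrite xz.
split => //; rewrite in_itv/= andbT; apply: lt_le_trans ry _; exact: nf.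
Qed.

Lemma lebesgue_measure_itvco {R : realType} (a b : R) : a <= b ->
  lebesgue_measure `[a, b[%classic = (b - a)%:E.
Proof.
move=> ab; apply: eq_trans (lebesgue_measure_itv _) _ => /=.
by move: ab; rewrite lte_fin le_eqVlt => /predU1P[->|->//]; rewrite ltxx subrr.
Qed.

(** * The integral of the weight *)

Section weight.
Context {R : realType} (h : R -> R).
Local Notation leb := (@lebesgue_measure R).

Definition below (x : \bar R) : set R := [set t | 0 <= t /\ (t%:E < x)%E].

(** Argument and value are extended reals because superlevel sets may have infinite measure. *)
Definition Wext (x : \bar R) : \bar R := (\int[leb]_(t in below x) (h t)%:E)%E.

Lemma below_itv x : is_interval (below x).
Proof.
move=> s t [s0 _] [_ tx] u /andP[su ut]; split; first exact: le_trans su.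
by apply: le_lt_trans tx; rewrite lee_fin.
Qed.

Lemma measurable_below x : measurable (below x).
Proof. by apply: is_interval_measurable; exact: below_itv. Qed.

Lemma below_fin s : below s%:E = `[0, s[%classic.
Proof.
apply/seteqP; split => t; rewrite /below/= in_itv/= lte_fin.
  by case=> -> ->.
by move=> /andP[].
Qed.

Lemma lebesgue_measure_below s : 0 <= s -> leb (below s%:E) = s%:E.
Proof. by move=> s0; rewrite below_fin lebesgue_measure_itvco// subr0. Qed.

Lemma subset_below x y : (x <= y)%E -> below x `<=` below y.
Proof. by move=> xy t [t0 tx]; split => //; exact: lt_le_trans xy. Qed.

Lemma Wext0 : Wext 0 = 0%E.
Proof. by rewrite /Wext below_fin set_itvco0 integral_set0. Qed.

Lemma Wint_Wext s : Wint h s = fine (Wext s%:E).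
Proof. by rewrite /Wext below_fin. Qed.

Context (m : \bar R) (wh : weight m h).

Lemma weight_gt0 x t : (x <= m)%E -> below x t -> 0 < h t.
Proof.
by case: wh => h0 _ _ xm [t0 tx]; apply: h0 => //; exact: lt_le_trans xm.
Qed.

Lemma weight_measurable x : (x <= m)%E -> measurable_fun (below x) (EFin \o h).
Proof.
case: wh => _ h1 _ xm; apply: nonincreasing_emeasurable; first exact: below_itv.
move=> s t [s0 _] [_ tx] st; rewrite /= lee_fin; apply: h1 => //.
exact: lt_le_trans xm.
Qed.

Lemma Wext_ge0 x : (x <= m)%E -> (0 <= Wext x)%E.
Proof.
move=> xm; apply: integral_ge0 => t tx; rewrite lee_fin; apply/ltW.
exact: weight_gt0 tx.
Qed.

Lemma le_Wext x y : (x <= y)%E -> (y <= m)%E -> (Wext x <= Wext y)%E.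
Proof.
move=> xy ym; apply: ge0_subset_integral.
- exact: measurable_below.
- exact: measurable_below.
- exact: weight_measurable.
- by move=> t yt; rewrite lee_fin ltW//; exact: weight_gt0 yt.
- exact: subset_below.
Qed.

(** [h] decreases from the real value [h 0], so it is bounded; finiteness of [Wext] at finite
    arguments follows. *)
Lemma Wext_le_cst s : 0 <= s -> (s%:E <= m)%E -> (Wext s%:E <= (h 0 * s)%:E)%E.
Proof.
case: (wh) => _ h1 _; rewrite le_eqVlt => /predU1P[<- _|s0 sm].
  by rewrite Wext0 mulr0.
have -> : (h 0 * s)%:E = (\int[leb]_(t in below s%:E) (h 0)%:E)%E.
  rewrite integral_cst; last exact: measurable_below.
  by rewrite /= lebesgue_measure_below// ltW.
apply: ge0_le_integral.
- exact: measurable_below.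
- by move=> t yt; rewrite lee_fin ltW//; exact: weight_gt0 yt.
- exact: weight_measurable.
- exact: measurable_cst.
- move=> t [t0 ts]; rewrite lee_fin; apply: h1 => //; exact: lt_le_trans sm.
Qed.

Lemma Wext_fin_num s : 0 <= s -> (s%:E <= m)%E -> Wext s%:E \is a fin_num.
Proof.
move=> s0 sm; rewrite ge0_fin_numE; last exact: Wext_ge0.
exact: le_lt_trans (Wext_le_cst _ s0 sm) (ltry _).
Qed.

Lemma cst_le_Wext s t : 0 <= t -> t <= s -> (s%:E < m)%E ->
  ((h s * t)%:E <= Wext t%:E)%E.
Proof.
case: (wh) => _ h1 _; rewrite le_eqVlt => /predU1P[<- _ _|t0 ts sm].
  by rewrite Wext0 mulr0.
have tm : (t%:E <= m)%E by apply: le_trans (ltW sm); rewrite lee_fin.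
have -> : (h s * t)%:E = (\int[leb]_(t in below t%:E) (h s)%:E)%E.
  rewrite integral_cst; last exact: measurable_below.
  by rewrite /= lebesgue_measure_below// ltW.
apply: ge0_le_integral.
- exact: measurable_below.
- move=> u _; rewrite lee_fin ltW//; case: wh => hp _ _; apply: hp => //.
  by rewrite ltW// (lt_le_trans t0).
- exact: measurable_cst.
- exact: weight_measurable.
- move=> u [u0]; rewrite lte_fin => ut; rewrite lee_fin; apply: h1 => //.
  by rewrite ltW// (lt_le_trans ut).
Qed.

Lemma Wext_gt0 x : (0 < x)%E -> (x <= m)%E -> (0 < Wext x)%E.
Proof.
move=> x0 xm.
(* [x] may be infinite or equal to [m]; a real [s] strictly below it is a point where [h s] is
   positive. *)
have [s [s0 sx]] : exists s : R, 0 < s /\ (s%:E < x)%E.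
  case: x x0 xm => [r|_ _|//]; last by exists 1; rewrite ltry.
  by rewrite lte_fin => r0 _; exists (r / 2); rewrite lte_fin; lra.
apply: lt_le_trans (le_Wext _ _ (ltW sx) xm).
have sm : (s%:E < m)%E by exact: lt_le_trans xm.
apply: lt_le_trans (cst_le_Wext s s (ltW s0) (lexx _) sm).
by rewrite lte_fin mulr_gt0//; case: wh => hp _ _; apply: hp => //; exact: ltW.
Qed.

(* Since [h] decreases, its mean over [s, C s[ is at most its mean over [0, s[. *)
Lemma Wext_scale C s r : 1 <= C -> 0 <= s -> 0 <= r -> r <= C * s ->
  (s%:E <= m)%E -> (r%:E <= m)%E -> (Wext r%:E <= C%:E * Wext s%:E)%E.
Proof.
move=> C1 s0 r0 rCs sm rm.
have W0 := Wext_ge0 _ sm.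
have [rs|sr] := leP r s.
  apply: (@le_trans _ _ (Wext s%:E)); first by apply: le_Wext => //; rewrite lee_fin.
  by rewrite -[leLHS]mul1e lee_wpmul2r// lee_fin.
have hs : (s%:E < m)%E by apply: lt_le_trans rm; rewrite lte_fin.
have -> : Wext r%:E = (Wext s%:E + \int[leb]_(t in `[s, r[) (h t)%:E)%E.
  have U : below r%:E = below s%:E `|` `[s, r[%classic.
    rewrite !below_fin; apply/seteqP; split => t /=; rewrite !in_itv/=.
      by move=> /andP[-> ->]; case: (ltP t s); [left|right].
    by move=> []/andP[? ?]; apply/andP; split; lra.
  rewrite /Wext U ge0_integral_setU//.
  - exact: measurable_below.
  - by rewrite -U; exact: weight_measurable.
  - by rewrite -U => t tr; rewrite lee_fin ltW//; exact: weight_gt0 tr.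
  - apply/disj_setPRL => t/=; rewrite in_itv/= below_fin /= in_itv/= => /andP[? ?].
    by move=> /andP[_]; lra.
have /le_trans : (\int[leb]_(t in `[s, r[) (h t)%:E <= (h s * (r - s))%:E)%E.
  have -> : (h s * (r - s))%:E = (\int[leb]_(t in `[s, r[) (h s)%:E)%E.
    by rewrite integral_cst//= lebesgue_measure_itvco// ltW.
  have sub : `[s, r[%classic `<=` below r%:E.
    by move=> t /=; rewrite in_itv/= => /andP[st tr]; split; [lra|rewrite lte_fin].
  apply: ge0_le_integral => //.
  - by move=> t /sub tr; rewrite lee_fin ltW//; exact: weight_gt0 tr.
  - apply: measurable_funS sub _; first exact: measurable_below.
    exact: weight_measurable.
  - move=> t /=; rewrite in_itv/= => /andP[st tr]; rewrite lee_fin.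
    by case: wh => _ h1 _; apply: h1 => //; apply: lt_le_trans rm; rewrite lte_fin.
move=> /(_ ((C - 1)%:E * Wext s%:E)%E) H.
have -> : (C%:E * Wext s%:E = Wext s%:E + (C - 1)%:E * Wext s%:E)%E.
  by rewrite -(fineK (Wext_fin_num _ s0 sm)) -!EFinM -EFinD; congr EFin; ring.
rewrite leeD2l//; apply: H.
have := cst_le_Wext _ _ s0 (lexx s) hs.
rewrite -(fineK (Wext_fin_num _ s0 sm)) -EFinM !lee_fin => H.
have hs0 : 0 < h s by case: wh => hp _ _; apply: hp.
apply: (@le_trans _ _ (h s * ((C - 1) * s))).
  by rewrite ler_pM2l//; lra.
by rewrite mulrCA ler_wpM2l//; lra.
Qed.

(** Because [t < x] is strict, the sets [below (x n)] exhaust [below y], and the integral is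
    continuous along increasing sets. *)
Lemma Wext_cvg (x : (\bar R)^nat) y : nondecreasing_seq x -> (y <= m)%E ->
  x n @[n --> \oo] --> y -> Wext (x n) @[n --> \oo] --> Wext y.
Proof.
move=> ndx ym xy.
have ysup : y = ereal_sup (range x).
  by rewrite -(cvg_lim _ xy)//; exact/cvg_lim/ereal_nondecreasing_cvgn.
have xley n : (x n <= y)%E by rewrite ysup; apply: ereal_sup_ubound; exists n.
have -> : Wext y = (\int[leb]_(t in \bigcup_n below (x n)) (h t)%:E)%E.
  rewrite /Wext; congr integral; apply/seteqP; split => [t [t0 ty]|t [n _]]; last first.
    exact: subset_below.
  by move: ty; rewrite ysup => /ereal_sup_gt[_ [n _ <-] tn]; exists n.
apply: ge0_nondecreasing_set_cvg_integral.
- by move=> i j ij; apply/subsetPset/subset_below/ndx.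
- by move=> i; exact: measurable_below.
- by move=> i; apply: weight_measurable; exact: le_trans ym.
- move=> i t tx; rewrite lee_fin ltW//; apply: weight_gt0 tx; exact: le_trans ym.
Qed.

End weight.


(** * Orlicz functions and their inverses *)

Section orlicz.
Context {R : realType} (phi phi_inv : R -> R).
Context (ophi : orlicz_function phi) (iphi : is_orlicz_inverse phi phi_inv).

Lemma orlicz_le x y : 0 <= x -> 0 <= y -> (phi x <= phi y) = (x <= y).
Proof.
case: ophi => _ _ _ mono _ x0 y0; have [xy|yx|->] := ltgtP x y; last exact: lexx.
  by rewrite ltW// mono.
by apply/negbTE; rewrite -ltNge mono.
Qed.

Lemma orlicz_lt x y : 0 <= x -> 0 <= y -> (phi x < phi y) = (x < y).
Proof. by move=> x0 y0; rewrite !ltNge orlicz_le. Qed.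

Lemma orlicz_ge0 x : 0 <= x -> 0 <= phi x.
Proof. by move=> x0; case: (ophi) => _ phi0 _ _ _; rewrite -phi0 orlicz_le. Qed.

Lemma orlicz_inv_ge0 y : 0 <= y -> 0 <= phi_inv y.
Proof. by case: iphi => _ /[apply] -[]. Qed.

Lemma orlicz_invK y : 0 <= y -> phi (phi_inv y) = y.
Proof. by case: iphi => _ /[apply] -[]. Qed.

Lemma orlicz_inv_lt y x : 0 <= y -> 0 <= x -> (phi_inv y < x) = (y < phi x).
Proof.
by move=> y0 x0; rewrite -[in RHS](orlicz_invK _ y0) orlicz_lt// orlicz_inv_ge0.
Qed.

Lemma orlicz_inv_le y z : 0 <= y -> 0 <= z -> (phi_inv y <= phi_inv z) = (y <= z).
Proof.
move=> y0 z0; rewrite -[in RHS](orlicz_invK _ y0) -[in RHS](orlicz_invK _ z0).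
by rewrite orlicz_le// orlicz_inv_ge0.
Qed.

Lemma orlicz_inv_gt0 y : 0 < y -> 0 < phi_inv y.
Proof.
move=> y0; rewrite lt_neqAle orlicz_inv_ge0 1?ltW// andbT; apply/eqP => e.
have := orlicz_invK _ (ltW y0); rewrite -e; case: ophi => _ -> _ _ _ y0'.
by move: y0; rewrite -y0' ltxx.
Qed.

(** Convexity between [x] and 0 with weight [c^-1], together with [phi 0 = 0]. *)
Lemma orlicz_div x c : 0 <= x -> 1 <= c -> phi (x / c) <= phi x / c.
Proof.
move=> x0 c1; have c0 : 0 < c by exact: lt_le_trans c1.
case: ophi => conv phi0 _ _ _; have := conv x 0 c^-1 x0 (lexx _).
rewrite !mulr0 phi0 mulr0 !addr0 ![c^-1 * _]mulrC; apply.
by rewrite invr_ge0 ltW//= invf_le1.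
Qed.

(** The inverse of a convex function is concave: [orlicz_div] is applied at [phi_inv (c * y)]. *)
Lemma orlicz_inv_scale y c : 0 <= y -> 1 <= c -> phi_inv (c * y) <= c * phi_inv y.
Proof.
move=> y0 c1; have c0 : 0 < c by exact: lt_le_trans c1.
have cy0 : 0 <= c * y by rewrite mulr_ge0// ltW.
rewrite [leRHS]mulrC -ler_pdivrMr// -(orlicz_le (_ / _)) ?orlicz_inv_ge0//; last first.
  by rewrite divr_ge0 ?orlicz_inv_ge0// ltW.
apply: (le_trans (orlicz_div _ _ _ c1)); first exact: orlicz_inv_ge0.
by rewrite !orlicz_invK// mulrAC divff ?mul1r// gt_eqF.
Qed.

Lemma le_phiE (x y : \bar R) : (0 <= x)%E -> (x <= y)%E -> (phiE phi x <= phiE phi y)%E.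
Proof.
case: x y => [x| |] [y| |]//=; rewrite ?leey// !lee_fin => x0 xy.
by rewrite orlicz_le// (le_trans x0).
Qed.

Lemma phiE_ge0 (x : \bar R) : (0 <= x)%E -> (0 <= phiE phi x)%E.
Proof. by case: x => [x| |]//=; rewrite !lee_fin; exact: orlicz_ge0. Qed.

Lemma lt_phiE (x : \bar R) u : (0 <= x)%E -> 0 <= u ->
  (u%:E < phiE phi x)%E = ((phi_inv u)%:E < x)%E.
Proof.
case: x => [x| |]//= + u0; rewrite ?ltry// lee_fin !lte_fin => x0.
by rewrite orlicz_inv_lt.
Qed.

End orlicz.

(** * Distribution function and rearrangement *)

Section rearrangement.
Context {R : realType} {d : measure_display} {X : measurableType d}.
Context (mu : {measure set X -> \bar R}).
Implicit Types g : X -> R.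

(** Continuity from below as a supremum, so that a strict lower bound on the measure of the union
    already holds at some [F n]. *)
Lemma nondecreasing_mu_sup (F : (set X)^nat) : (forall i, measurable (F i)) ->
  nondecreasing_seq F -> mu (\bigcup_n F n) = ereal_sup (range (mu \o F)).
Proof.
move=> mF ndF; have mUF : measurable (\bigcup_n F n) by exact: bigcupT_measurable.
rewrite -(cvg_lim _ (nondecreasing_cvg_mu mF mUF ndF))//.
apply/cvg_lim/ereal_nondecreasing_cvgn => // i j ij /=.
by rewrite le_measure ?inE//; apply/subsetPset/ndF.
Qed.

Lemma measurable_superlevel g l : measurable_fun setT g ->
  measurable [set x | l < `|g x|].
Proof.
move=> mg; rewrite -[X in measurable X]setTI.
have mn : measurable_fun setT (fun x => `|g x|) by exact: measurableT_comp.
rewrite (_ : [set _ | _] = (fun x => `|g x|) @^-1` `]l, +oo[%classic); last first.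
  by apply/seteqP; split => x /=; rewrite in_itv/= andbT.
by apply: mn => //; exact: measurable_itv.
Qed.

Lemma le_distrib g1 g2 l1 l2 : measurable_fun setT g1 -> measurable_fun setT g2 ->
  (forall x, l1 < `|g1 x| -> l2 < `|g2 x|) ->
  (distrib mu g1 l1 <= distrib mu g2 l2)%E.
Proof.
by move=> m1 m2 le12; rewrite le_measure ?inE//; exact: measurable_superlevel.
Qed.

Lemma rearr_ge0 g t : (0 <= rearr mu g t)%E.
Proof.
by apply: le_ereal_inf_tmp => _ [l [l0 _] <-]; rewrite lee_fin ltW.
Qed.

Lemma rearr_nonincreasing g s t : s <= t -> (rearr mu g t <= rearr mu g s)%E.
Proof.
move=> st; apply: ereal_inf_le_tmp => _ [l [l0 ls] <-]; exists l => //.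
by split => //; apply: le_trans ls _; rewrite lee_fin.
Qed.

(** [rearr] and [distrib] are generalized inverses of each other; the strict form rests on right
    continuity of the distribution function. *)
Lemma lt_rearr g l t : measurable_fun setT g -> 0 <= l ->
  (l%:E < rearr mu g t)%E = (t%:E < distrib mu g l)%E.
Proof.
move=> mg l0; apply/idP/idP => [|tl].
  (* [l] may be 0, which the infimum excludes, so the levels [l + e] are used instead. *)
  apply: contraLR; rewrite -!leNgt => lt; apply/lee_addgt0Pr => e e0.
  apply: ereal_inf_lbound; exists (l + e); rewrite ?EFinD//; split.
    by rewrite ltr_wpDl.
  apply: le_trans lt; apply: le_distrib => // x; apply: le_lt_trans.
  by rewrite lerDl ltW.
pose F n := [set x | l + n.+1%:R^-1 < `|g x|].
have mF n : measurable (F n) by exact: measurable_superlevel.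
have ndF : nondecreasing_seq F.
  move=> i j ij; apply/subsetPset => x; apply: le_lt_trans.
  by rewrite lerD2l lef_pV2 ?posrE// ler_nat.
have FU : [set x | l < `|g x|] = \bigcup_n F n.
  apply/seteqP; split => [x /= lx|x [n _]]; last first.
    by apply: le_lt_trans; rewrite lerDl.
  have [n nx] := ltr_add_invr lx; by exists n.
move: tl; rewrite /distrib FU nondecreasing_mu_sup// => /ereal_sup_gt[_ [n _ <-] tn].
apply: (@lt_le_trans _ _ (l + n.+1%:R^-1)%:E); first by rewrite lte_fin ltrDl.
apply: le_ereal_inf_tmp => _ [k [k0 kt] <-]; rewrite lee_fin leNgt.
apply/negP => kl; move: tn; apply/negP; rewrite -leNgt; apply: le_trans kt.
by apply: (le_distrib g g) => // x; apply: lt_trans.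
Qed.

End rearrangement.


(** * The modular: layer cake form, doubling, indicators *)

Section modular.
Context {R : realType} {d : measure_display} {X : measurableType d}.
Context (mu : {measure set X -> \bar R}) (phi phi_inv h : R -> R).
Context (ophi : orlicz_function phi) (iphi : is_orlicz_inverse phi phi_inv).
Context (wh : weight (mu setT) h).
Local Notation leb := (@lebesgue_measure R).
Implicit Types g : X -> R.

Lemma measure_leT (A : set X) : measurable A -> (mu A <= mu setT)%E.
Proof. by move=> mA; apply: le_measure; rewrite ?inE. Qed.

Lemma distrib_leT g l : measurable_fun setT g -> (distrib mu g l <= mu setT)%E.
Proof. by move=> mg; apply: measure_leT; exact: measurable_superlevel. Qed.

Lemma lebesgue_measure_belowE (x : \bar R) : (0 <= x)%E -> leb (below x) = x.
Proof.
case: x => [x| |]//; first exact: lebesgue_measure_below.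
move=> _; have -> : @below R +oo = `[0, +oo[%classic.
  apply/seteqP; split => t /=; rewrite /below/= in_itv/= andbT ltry.
    by case.
  by [].
by apply: eq_trans (lebesgue_measure_itv _) _; rewrite /= ltry.
Qed.

Let pos : set R := `[0, +oo[%classic.

(* For [u >= 0], [u < phi (g^* t)] iff [t < mu_g (phi^-1 u)], so Tonelli's
   theorem exchanges the roles of the rearrangement and of the distribution
   function. *)
Lemma Imod_layer_cake g : measurable_fun setT g ->
  Imod mu phi h g = (\int[leb]_(u in pos) Wext h (distrib mu g (phi_inv u)))%E.
Proof.
move=> mg; pose D := below (mu setT); pose H := h \_ D.
have mD : measurable D by exact: measurable_below.
have mh : measurable_fun D h.
  by apply/measurable_EFinP; exact: (weight_measurable _ _ wh).
have H0 t : 0 <= H t.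
  rewrite /H/patch; case: ifPn => //; rewrite inE => Dt; apply/ltW.
  exact: (weight_gt0 _ _ wh) Dt.
have mH : measurable_fun setT H by apply/(measurable_restrictT _ _).1.
(* [phi_inv] is only controlled on nonnegative reals; the truncation makes [m] monotone on the whole
   line. *)
pose m u := distrib mu g (phi_inv (Order.max u 0)).
have mm : measurable_fun setT m.
  apply: nonincreasing_emeasurable => [//|u v _ _ uv].
  apply: le_distrib => // x.
  have max0 (w : R) : 0 <= Order.max w 0 by rewrite le_max lexx orbT.
  apply: le_lt_trans; rewrite (orlicz_inv_le _ _ ophi iphi)//.
  by rewrite ge_max !le_max uv lexx orbT.
(* The points under the graph of [m]; negative [t] are cut off by [H], which vanishes there. *)
pose S := [set z : R * R | 0 <= z.2] `&` [set z : R * R | (z.1%:E < m z.2)%E].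
have mS : measurable S.
  apply: measurableI.
    rewrite -[X in measurable X]setTI.
    rewrite (_ : [set z | _] = snd @^-1` pos); last first.
      by apply/seteqP; split => x; rewrite /pos/= in_itv/= andbT.
    by apply: measurable_snd => //; exact: measurable_itv.
  rewrite -[X in measurable X]setTI; apply: measurable_lte => //.
    by apply/measurable_EFinP; exact: measurable_fst.
  exact: (measurableT_comp mm measurable_snd).
pose f (z : R * R) : \bar R := (H z.1 * \1_S z)%:E.
have mf : measurable_fun setT f.
  apply/measurable_EFinP/measurable_funM; last exact: measurable_indic.
  exact: (measurableT_comp mH measurable_fst).
have f0 z : (0 <= f z)%E by rewrite lee_fin mulr_ge0.
have -> : Imod mu phi h g = (\int[leb]_t \int[leb]_u f (t, u))%E.
  rewrite /Imod -/(below (mu setT)) integral_mkcond; apply: eq_integral => t _.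
  rewrite /patch; case: ifPn => [|/negPf tD]; last first.
    rewrite integral0_eq// => u _; rewrite /f /= /H /patch.
    by rewrite /D tD mul0r.
  rewrite inE => Dt; have [t0 tm] := Dt.
  have r0 : (0 <= phiE phi (rearr mu g t))%E.
    by apply: phiE_ge0 => //; exact: rearr_ge0.
  under eq_integral do rewrite /f EFinM/=.
  have -> : H t = h t by rewrite /H patchE mem_set.
  rewrite ge0_integralZl_EFin//; last 2 first.
  - apply/measurable_EFinP.
    apply: (measurableT_comp (measurable_indic mS)); exact: pair1_measurable.
  - by apply/ltW; exact: (weight_gt0 _ _ wh) Dt.
  rewrite muleC; congr (_ * _)%E.
  (* The value of [phi] at the rearrangement is the length of the interval [below] it, and this
     interval is the section of [S] at [t]. *)
  rewrite -[LHS]lebesgue_measure_belowE// -[below _]setIT -integral_indic//; last first.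
    exact: measurable_below.
  apply: eq_integral => u _; rewrite !indicE; congr (_%:R%:E); congr nat_of_bool.
  apply/idP/idP; rewrite !inE /S /below /=.
    move=> [u0]; rewrite (lt_phiE _ _ ophi iphi) ?rearr_ge0// lt_rearr//.
      by rewrite /m max_l.
    exact: (orlicz_inv_ge0 _ _ iphi).
  move=> [u0]; rewrite (lt_phiE _ _ ophi iphi) ?rearr_ge0// lt_rearr//.
    by rewrite /m max_l.
  exact: (orlicz_inv_ge0 _ _ iphi).
rewrite fubini_tonelli// [RHS]integral_mkcond; apply: eq_integral => u _.
rewrite patchE; case: ifPn => [|up]; last first.
  rewrite integral0_eq// => t _; rewrite /f indicE memNset ?mulr0//.
  by move=> [/= u0 _]; move: up; rewrite notin_setE; apply; rewrite /pos/= in_itv/= u0.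
rewrite inE /pos/= in_itv/= andbT => u0.
(* For fixed [u >= 0], the section of [S] within [D] is the interval [below] the distribution
   function. *)
rewrite /Wext [RHS]integral_mkcond; apply: eq_integral => t _.
rewrite /f /= indicE /H !patchE.
have mE : m u = distrib mu g (phi_inv u) by rewrite /m max_l.
have [[t0 tb]|tb] := pselect (below (distrib mu g (phi_inv u)) t).
  have DT : D t by split => //; apply: lt_le_trans tb _; exact: distrib_leT.
  have ST : S (t, u) by split; rewrite //= mE.
  by rewrite !mem_set ?mulr1.
rewrite [t \in below (distrib _ _ _)]memNset//.
have [[_ /= tm]|nS] := pselect (S (t, u)); last first.
  by rewrite [X in nat_of_bool X]memNset ?mulr0.
by rewrite [t \in D]memNset ?mul0r// => -[t0 _]; apply: tb; rewrite -mE.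
Qed.

Lemma measurable_Wext_distrib g : measurable_fun setT g ->
  measurable_fun pos (fun u => Wext h (distrib mu g (phi_inv u))).
Proof.
move=> mg; apply: nonincreasing_emeasurable.
  exact: interval_is_interval.
move=> u v /=; rewrite /pos/= !in_itv/= !andbT => u0 v0 uv.
apply: (le_Wext _ _ wh); last exact: distrib_leT.
apply: le_distrib => // x; apply: le_lt_trans.
by rewrite (orlicz_inv_le _ _ ophi iphi).
Qed.

Lemma measurable_modular g : measurable_fun setT g ->
  measurable_fun (domw mu) (fun t => phiE phi (rearr mu g t) * (h t)%:E)%E.
Proof.
move=> mg; apply: emeasurable_funM; last exact: (weight_measurable _ _ wh).
apply: nonincreasing_emeasurable; first exact: below_itv.
move=> s t _ _ st; apply: (le_phiE _ ophi); first exact: rearr_ge0.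
exact: rearr_nonincreasing.
Qed.

Lemma Imod_ge0 g : (0 <= Imod mu phi h g)%E.
Proof.
apply: integral_ge0 => t Dt; apply: mule_ge0.
  by apply: (phiE_ge0 _ ophi); exact: rearr_ge0.
by rewrite lee_fin ltW//; exact: (weight_gt0 _ _ wh) Dt.
Qed.

(** The pointwise bound passes to the rearrangements with the same factor 2, and the doubling
    condition is then integrated. *)
Lemma Imod_doubling K g1 g2 : 0 < K -> (forall s, 0 < s -> phi (2 * s) <= K * phi s) ->
  measurable_fun setT g1 -> measurable_fun setT g2 ->
  (forall x, `|g1 x| <= 2 * `|g2 x|) ->
  (Imod mu phi h g1 <= K%:E * Imod mu phi h g2)%E.
Proof.
move=> K0 dbl m1 m2 g12; rewrite -ge0_integralZl_EFin; last 4 first.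
- exact: measurable_below.
- move=> t Dt; apply: mule_ge0.
    by apply: (phiE_ge0 _ ophi); exact: rearr_ge0.
  by rewrite lee_fin ltW//; exact: (weight_gt0 _ _ wh) Dt.
- exact: measurable_modular.
- exact: ltW.
apply: ge0_le_integral.
- exact: measurable_below.
- move=> t Dt; apply: mule_ge0.
    by apply: (phiE_ge0 _ ophi); exact: rearr_ge0.
  by rewrite lee_fin ltW//; exact: (weight_gt0 _ _ wh) Dt.
- exact: measurable_modular.
- by apply: measurable_funeM; exact: measurable_modular.
move=> t Dt; have ht : (0 < h t)%R by exact: (weight_gt0 _ _ wh) Dt.
rewrite muleA; apply: lee_wpmul2r; first by rewrite lee_fin ltW.
have := rearr_ge0 mu g2 t; case E2 : (rearr mu g2 t) => [r| |]// r0; last first.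
  by rewrite /= gt0_muley ?lte_fin// leey.
have := rearr_ge0 mu g1 t.
have : (rearr mu g1 t <= (2 * r)%:E)%E.
  rewrite leNgt lt_rearr//; last by rewrite mulr_ge0.
  rewrite -leNgt; apply: (@le_trans _ _ (distrib mu g2 r)).
    by apply: le_distrib => // x rx; have := g12 x; lra.
  by rewrite leNgt -lt_rearr// E2 ltxx.
case: (rearr mu g1 t) => [s| |]//; rewrite !lee_fin => sr s0 /=.
apply: (@le_trans _ _ (phi (2 * r))).
  by rewrite (orlicz_le _ ophi)// mulr_ge0.
(* The doubling hypothesis covers positive arguments; at 0 both sides vanish. *)
move: r0; rewrite lee_fin le_eqVlt => /predU1P[<-|/dbl//].
by case: ophi => _ phi0 _ _ _; rewrite mulr0 phi0 mulr0.
Qed.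

(** The distribution function is [mu A] below level [a] and 0 from [a] on, so the layer cake
    integrand is constant for [u] below [phi a] and then zero. *)
Lemma Imod_indic a A : measurable A -> 0 < a ->
  Imod mu phi h (fun x => a * \1_A x) = ((phi a)%:E * Wext h (mu A))%E.
Proof.
move=> mA a0; have mg : measurable_fun setT (fun x => a * \1_A x : R).
  by apply: measurable_funM => //; exact: measurable_indic.
rewrite Imod_layer_cake//.
have dE l : 0 <= l -> distrib mu (fun x => a * \1_A x) l = if l < a then mu A else 0%E.
  move=> l0; rewrite /distrib; case: ifPn => la.
    congr (mu _); apply/seteqP; split => x /=; rewrite indicE.
      by case: (asboolP (A x)) => [//|nA]; rewrite memNset// mulr0 normr0 ltNge l0.
    by move=> Ax; rewrite mem_set// mulr1 gtr0_norm.
  rewrite -[RHS](measure0 mu); congr (mu _); apply/seteqP; split => x //=.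
  rewrite indicE; case: (x \in A); rewrite ?mulr0 ?normr0 ?mulr1 ltNge ?l0//.
  by rewrite gtr0_norm// leNgt la.
have pa0 : 0 <= phi a by apply: (orlicz_ge0 _ ophi); exact: ltW.
have -> : ((phi a)%:E * Wext h (mu A) =
    \int[leb]_(u in below (phi a)%:E) cst (Wext h (mu A)) u)%E.
  rewrite integral_cst; last exact: measurable_below.
  by rewrite muleC /= lebesgue_measure_below.
rewrite integral_mkcond [RHS]integral_mkcond; apply: eq_integral => u _.
rewrite !patchE below_fin; have [u0|u0] := leP 0 u; last first.
  by rewrite !memNset// /pos /= in_itv/= leNgt u0.
rewrite [u \in pos]mem_set; last by rewrite /pos/= in_itv/= u0.
rewrite dE; last exact: (orlicz_inv_ge0 _ _ iphi).
rewrite (orlicz_inv_lt _ _ ophi iphi)//; last exact: ltW.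
case: ifPn => ua; first by rewrite mem_set// /= in_itv/= u0.
by rewrite memNset ?Wext0// /= in_itv/= u0 (negPf ua).
Qed.

End modular.


(** * Iterates of an invertible map *)

Lemma can_iter {T : Type} (f g : T -> T) n : cancel f g -> cancel (iter n f) (iter n g).
Proof. by move=> fK; elim: n => // n IH x; rewrite iterSr iterS fK IH. Qed.

Lemma image_iter {T : Type} (f g : T -> T) n (A : set T) :
  cancel f g -> cancel g f -> iter n f @` A = iter n g @^-1` A.
Proof.
move=> fK gK.
apply/seteqP; split => [_ [x Ax <-]|x gA] /=; first by rewrite can_iter.
by exists (iter n g x) => //; exact: can_iter.
Qed.

Lemma preimage_iterD {T : Type} (f : T -> T) m n (A : set T) :
  iter (m + n) f @^-1` A = iter n f @^-1` (iter m f @^-1` A).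
Proof. by apply/seteqP; split => x /=; rewrite iterD. Qed.

Lemma measurable_fun_iter {d} {T : measurableType d} (f : T -> T) n :
  measurable_fun setT f -> measurable_fun setT (iter n f).
Proof.
by move=> mf; elim: n => [|n IH]; [exact: measurable_id|exact: measurableT_comp].
Qed.

Lemma measurable_preimageT {d} {T : measurableType d} (f : T -> T) A :
  measurable_fun setT f -> measurable A -> measurable (f @^-1` A).
Proof. by move=> mf mA; rewrite -[X in measurable X]setTI; apply: mf. Qed.

(** * The fundamental function on sets of finite positive measure *)

Section fundamental_function.
Context {R : realType} {d : measure_display} {X : measurableType d}.
Context (mu : {measure set X -> \bar R}) (phi phi_inv h : R -> R).
Context (ophi : orlicz_function phi) (iphi : is_orlicz_inverse phi phi_inv).
Context (wh : weight (mu setT) h).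

Definition finite_pos (A : set X) : Prop := measurable A /\ (0 < mu A < +oo)%E.

Local Notation fund := (fundOL mu phi_inv h).

(** On these sets no default value of [fine] enters [fundOL], so it can be exchanged for the
    extended-valued [Wext]. *)
Lemma finite_pos_Wext A : finite_pos A ->
  exists2 w : R, 0 < w & Wext h (mu A) = w%:E /\ fund A = phi_inv (1 / w).
Proof.
move=> [mA /andP[A0 Afin]].
have AT : (mu A <= mu setT)%E by exact: measure_leT.
have Af : mu A \is a fin_num by rewrite ge0_fin_numE// ltW.
have AE := fineK Af.
have Wf : Wext h (mu A) \is a fin_num.
  rewrite -AE; apply: (Wext_fin_num _ _ wh); last by rewrite AE.
  by apply: fine_ge0.
have W0 : (0 < Wext h (mu A))%E by exact: (Wext_gt0 _ _ wh).
exists (fine (Wext h (mu A))); first by rewrite fine_gt0// W0 ltey_eq Wf.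
by split; [rewrite fineK|rewrite /fundOL Wint_Wext AE].
Qed.

Lemma fund_gt0 A : finite_pos A -> 0 < fund A.
Proof.
move=> /finite_pos_Wext[w w0 [_ ->]]; apply: (orlicz_inv_gt0 _ _ ophi iphi).
by rewrite divr_gt0.
Qed.

(** By [Imod_indic] a level [l] is admissible iff [phi (a / l) <= 1 / w], that is,
    [a / fund A <= l]; the infimum is attained. *)
Lemma OLnorm_indic a A : finite_pos A -> 0 < a ->
  OLnorm mu phi h (fun x => a * \1_A x) = (a / fund A)%:E.
Proof.
move=> fA a0; have f0 := fund_gt0 _ fA; have [mA _] := fA.
have [w w0 [WE fE]] := finite_pos_Wext _ fA.
have key (l : R) : 0 < l ->
    (Imod mu phi h (fun x => ((a * \1_A x) / l)%R) <= 1)%E = (a / fund A <= l).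
  move=> l0; rewrite (_ : (fun _ => _) = (fun x => (a / l) * \1_A x)); last first.
    by apply/funext => x; rewrite mulrAC.
  have al0 : 0 < a / l by rewrite divr_gt0.
  rewrite (Imod_indic _ _ _ _ ophi iphi wh)// WE -EFinM lee_fin -ler_pdivlMr//.
  have w10 : 0 <= 1 / w by rewrite divr_ge0// ltW.
  rewrite -[in LHS](orlicz_invK _ _ iphi _ w10) -fE (orlicz_le _ ophi); [|exact: ltW|exact: ltW].
  by rewrite ler_pdivrMr// ler_pdivrMr// mulrC.
apply/eqP; rewrite eq_le; apply/andP; split.
  apply: ereal_inf_lbound; exists (a / fund A) => //.
  by split; [rewrite divr_gt0|rewrite key// divr_gt0].
by apply: le_ereal_inf_tmp => _ [l [l0 +] <-]; rewrite key// lee_fin.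
Qed.

(** A factor [C] on the measure is at most a factor [C] on [Wext], hence, by concavity of [phi_inv],
    at most a factor [C] on [fund]. *)
Lemma fund_le_scale A B C : finite_pos A -> finite_pos B -> 1 <= C ->
  (mu A <= C%:E * mu B)%E -> fund B <= C * fund A.
Proof.
move=> fA fB C1 AB.
have [a a0 [aE ->]] := finite_pos_Wext _ fA.
have [b b0 [bE ->]] := finite_pos_Wext _ fB.
have C0 : 0 < C by exact: lt_le_trans C1.
have ab : a <= C * b.
  move: fA fB => [mA /andP[A0 Ay]] [mB /andP[B0 By]].
  have Af : mu A \is a fin_num by rewrite ge0_fin_numE// ltW.
  have Bf : mu B \is a fin_num by rewrite ge0_fin_numE// ltW.
  have fab : fine (mu A) <= C * fine (mu B) by rewrite -lee_fin EFinM !fineK.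
  rewrite -lee_fin EFinM -aE -bE -(fineK Af) -(fineK Bf).
  by apply: (Wext_scale _ _ wh _ _ _ C1 _ _ fab); rewrite ?fine_ge0 ?fineK// measure_leT.
apply: (@le_trans _ _ (phi_inv (C * (1 / a)))).
  have ia : 0 <= C * (1 / a) by rewrite ltW// mulr_gt0// divr_gt0.
  have ib : 0 <= 1 / b by rewrite ltW// divr_gt0.
  rewrite (orlicz_inv_le _ _ ophi iphi)//.
  by rewrite !div1r -[leLHS]mul1r ler_pdivrMr// mulrAC ler_pdivlMr// mul1r.
by apply: (orlicz_inv_scale _ _ ophi iphi) => //; rewrite divr_ge0// ltW.
Qed.

(** From [fund B < fund A / K], convexity gives [phi (fund B) <= phi (fund A) / K], which compares
    the reciprocals of the two values of [Wext]. *)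
Lemma Wext_growth A B K : finite_pos A -> finite_pos B -> 1 <= K ->
  K < fund A / fund B -> (K%:E * Wext h (mu A) <= Wext h (mu B))%E.
Proof.
move=> fA fB K1; have K0 : 0 < K by exact: lt_le_trans K1.
rewrite ltr_pdivlMr ?fund_gt0//.
have [a a0 [-> ->]] := finite_pos_Wext _ fA.
have [b b0 [-> ->]] := finite_pos_Wext _ fB.
have ia : 0 <= 1 / a by rewrite divr_ge0// ltW.
have ib : 0 <= 1 / b by rewrite divr_ge0// ltW.
have fa0 := orlicz_inv_ge0 _ _ iphi _ ia.
have fb0 := orlicz_inv_ge0 _ _ iphi _ ib.
rewrite mulrC -ltr_pdivlMr// => /ltW.
rewrite -(orlicz_le _ ophi)//; last by rewrite divr_ge0// ltW.
move=> /le_trans /(_ (orlicz_div _ ophi _ _ fa0 K1)).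
rewrite !(orlicz_invK _ _ iphi)// !div1r -invfM lef_pV2 ?posrE ?mulr_gt0//.
by rewrite -EFinM lee_fin mulrC.
Qed.

(* The level sets of [g] may have infinite measure: exhaust them by sets of
   finite measure. *)
Lemma Wext_sum_growth K (f1 f2 : X -> X) : sigma_finite setT mu -> 1 <= K ->
  measurable_fun setT f1 -> measurable_fun setT f2 ->
  (forall A, finite_pos A -> finite_pos (f1 @^-1` A) /\ finite_pos (f2 @^-1` A)) ->
  (forall A, finite_pos A ->
    K < fund A / fund (f1 @^-1` A) \/ K < fund A / fund (f2 @^-1` A)) ->
  forall E, measurable E ->
  (K%:E * Wext h (mu E) <= Wext h (mu (f1 @^-1` E)) + Wext h (mu (f2 @^-1` E)))%E.
Proof.
move=> /sigma_finiteP[F [FT ndF mF]] K1 m1 m2 fp grow E mE.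
have K0 : 0 < K by exact: lt_le_trans K1.
have W0 A : measurable A -> (0 <= Wext h (mu A))%E.
  by move=> mA; apply: (Wext_ge0 _ _ wh); exact: measure_leT.
have Wle A B : measurable A -> measurable B -> A `<=` B ->
    (Wext h (mu A) <= Wext h (mu B))%E.
  move=> mA mB AB; apply: (le_Wext _ _ wh); last exact: measure_leT.
  by apply: le_measure; rewrite ?inE.
pose G n := E `&` F n.
have mG n : measurable (G n) by apply: measurableI => //; have [] := mF n.
have ndG : nondecreasing_seq G.
  by move=> i j ij; apply/subsetPset; apply: setIS; exact/subsetPset/ndF.
have GE : \bigcup_n G n = E by rewrite -setI_bigcupr -FT setIT.
have Gbound n : (K%:E * Wext h (mu (G n)) <=
    Wext h (mu (f1 @^-1` E)) + Wext h (mu (f2 @^-1` E)))%E.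
  apply: (@le_trans _ _ (Wext h (mu (f1 @^-1` G n)) +
      Wext h (mu (f2 @^-1` G n)))%E); last first.
    by apply: leeD; apply: Wle; try exact: measurable_preimageT; move=> x [].
  (* Growth is assumed on sets of positive measure; a null [G n] makes the left side zero. *)
  have [G0|G0] := eqVneq (mu (G n)) 0%E.
    by rewrite G0 Wext0 mule0 adde_ge0// W0//; exact: measurable_preimageT.
  have fG : finite_pos (G n).
    split => //; rewrite lt0e G0 measure_ge0/=.
    have [mFn] := mF n; apply: le_lt_trans.
    by apply: le_measure; rewrite ?inE//; exact: subIsetr.
  have [fG1 fG2] := fp _ fG.
  have [g1|g2] := grow _ fG.
    by apply: (le_trans (Wext_growth _ _ _ fG fG1 K1 g1));
      rewrite leeDl// W0//; exact: measurable_preimageT.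
  by apply: (le_trans (Wext_growth _ _ _ fG fG2 K1 g2));
    rewrite leeDr// W0//; exact: measurable_preimageT.
(* The bound passes to the limit by continuity from below of [mu] and [Wext]. *)
have cG : Wext h (mu (G n)) @[n --> \oo] --> Wext h (mu E).
  apply: (Wext_cvg _ _ wh).
  - by move=> i j ij; rewrite le_measure ?inE//; exact/subsetPset/ndG.
  - exact: measure_leT.
  - by rewrite -GE; apply: nondecreasing_cvg_mu => //; rewrite GE.
have cKG : (K%:E * Wext h (mu (G n)))%E @[n --> \oo] --> (K%:E * Wext h (mu E))%E.
  exact: cvgeZl.
by apply: cvge_to_le cKG _; exact: nearW.
Qed.

End fundamental_function.


(** * Growth along the iterates, for sets and for functions *)

Section dynamics.
Context {R : realType} {d : measure_display} {X : measurableType d}.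
Context (mu : {measure set X -> \bar R}) (phi phi_inv h : R -> R).
Context (ophi : orlicz_function phi) (iphi : is_orlicz_inverse phi phi_inv).
Context (wh : weight (mu setT) h).
Implicit Types s : X -> X.

Local Notation fund := (fundOL mu phi_inv h).

Definition pullback_bounded s (M : R) : Prop :=
  forall A, measurable A -> (mu (s @^-1` A) <= M%:E * mu A)%E.

(** The bound along [s'] keeps the measure finite; the bound along [s] keeps it positive, since
    pulling back along [s] recovers [A]. *)
Lemma finite_pos_preimage s s' M M' A : cancel s s' -> measurable_fun setT s' ->
  pullback_bounded s M -> pullback_bounded s' M' ->
  finite_pos mu A -> finite_pos mu (s' @^-1` A).
Proof.
move=> sK ms' bs bs' [mA /andP[A0 Ay]].
have mA' := measurable_preimageT _ _ ms' mA.
have Af : mu A \is a fin_num by rewrite ge0_fin_numE// ltW.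
split => //; apply/andP; split; last first.
  by apply: (le_lt_trans (bs' _ mA)); rewrite -(fineK Af) -EFinM ltry.
rewrite lt0e measure_ge0 andbT; apply/eqP => A'0.
have := bs _ mA'; rewrite A'0 mule0 => /(lt_le_trans _).
have -> : s @^-1` (s' @^-1` A) = A by apply/seteqP; split => x /=; rewrite sK.
by move=> /(_ _ A0); rewrite ltxx.
Qed.

Lemma finite_pos_iter s s' M M' n A : cancel s s' -> measurable_fun setT s' ->
  pullback_bounded s M -> pullback_bounded s' M' ->
  finite_pos mu A -> finite_pos mu (iter n s' @^-1` A).
Proof.
move=> sK ms' bs bs' fA; elim: n => // n IH.
rewrite -addn1 preimage_iterD.
exact: (finite_pos_preimage _ _ _ _ _ sK ms' bs bs' IH).
Qed.

(** [fund] decreases as the measure grows, so its growth along [s'] is limited by the bound along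
    the inverse [s]. The maximum with 1 meets the condition [1 <= C] of [fund_le_scale]. *)
Lemma fund_preimage_iter_le s s' M M' n A : cancel s s' -> measurable_fun setT s' ->
  pullback_bounded s M -> pullback_bounded s' M' ->
  finite_pos mu A -> fund (iter n s' @^-1` A) <= Num.max 1 M ^+ n * fund A.
Proof.
move=> sK ms' bs bs' fA; elim: n => [|n IH]; first by rewrite mul1r.
have fn := finite_pos_iter _ _ _ _ n _ sK ms' bs bs' fA.
have fn1 := finite_pos_preimage _ _ _ _ _ sK ms' bs bs' fn.
have [mn _] := fn; have [mn1 _] := fn1.
rewrite -addn1 preimage_iterD addn1 exprS -mulrA.
apply: (@le_trans _ _ (Num.max 1 M * fund (iter n s' @^-1` A))).
  apply: (fund_le_scale _ _ _ _ ophi iphi wh) => //; first by rewrite le_max lexx.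
  have nE : s @^-1` (s' @^-1` (iter n s' @^-1` A)) = iter n s' @^-1` A.
    by apply/seteqP; split => x /=; rewrite sK.
  have := bs _ mn1; rewrite nE => /le_trans; apply; apply: lee_wpmul2r => //.
  by rewrite lee_fin le_max lexx orbT.
by rewrite ler_wpM2l// le_max ler01.
Qed.

(* If [fund] halves along [s'^n] at [A], it cannot halve along [s^n] at
   [s'^n A], hence it halves again along [s'^n]; the bounded remainder modulo [n]
   is absorbed by the constant of [fund_preimage_iter_le]. *)
Lemma fund_uniform_growth s s' M M' n : cancel s s' -> cancel s' s ->
  measurable_fun setT s -> measurable_fun setT s' ->
  pullback_bounded s M -> pullback_bounded s' M' ->
  (forall A, finite_pos mu A -> 2 * fund (iter n s' @^-1` A) <= fund A \/
                                2 * fund (iter n s @^-1` A) <= fund A) ->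
  forall K : R, exists N : nat, forall m, (N <= m)%N -> forall A, finite_pos mu A ->
    2 * fund (iter n s' @^-1` A) <= fund A -> K < fund A / fund (iter m s' @^-1` A).
Proof.
move=> sK s'K ms ms' bs bs' dich K.
have it k A := finite_pos_iter _ _ _ _ k A sK ms' bs bs'.
have step A : finite_pos mu A -> 2 * fund (iter n s' @^-1` A) <= fund A ->
    2 * fund (iter n s' @^-1` (iter n s' @^-1` A)) <= fund (iter n s' @^-1` A).
  move=> fA HA; have [//|] := dich _ (it n _ fA).
  have -> : iter n s @^-1` (iter n s' @^-1` A) = A.
    by apply/seteqP; split => x /=; rewrite can_iter.
  have f0 := fund_gt0 _ _ _ _ ophi iphi wh _ fA.
  have f1 := fund_gt0 _ _ _ _ ophi iphi wh _ (it n _ fA).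
  move: HA; lra.
have grow k A : finite_pos mu A -> 2 * fund (iter n s' @^-1` A) <= fund A ->
    2 ^+ k * fund (iter (n * k) s' @^-1` A) <= fund A.
  move=> fA HA.
  (* The induction also carries the halving at the current set, which [step] propagates. *)
  suff [] : 2 ^+ k * fund (iter (n * k) s' @^-1` A) <= fund A /\
      2 * fund (iter n s' @^-1` (iter (n * k) s' @^-1` A))
        <= fund (iter (n * k) s' @^-1` A) by [].
  elim: k => [|k [IH1 IH2]]; first by rewrite muln0 mul1r.
  rewrite mulnSr preimage_iterD; split; last exact: step (it _ _ fA) IH2.
  by apply: le_trans IH1; rewrite exprSr -mulrA ler_wpM2l// exprn_ge0.
(* For [n = 0] halving contradicts the positivity of [fund]. *)
have [->|n0] := eqVneq n 0%N.
  exists 0%N => m _ A fA; have := fund_gt0 _ _ _ _ ophi iphi wh _ fA.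
  by rewrite (_ : iter 0 s' @^-1` A = A)//; lra.
pose C := Num.max 1 M.
have C1 : 1 <= C by rewrite le_max lexx.
have Cn0 : 0 < C ^+ n by rewrite exprn_gt0// (lt_le_trans ltr01).
(* The factor [C ^+ n] pays for the remainder [m %% n]. *)
have [k Kk] : exists k : nat, K * C ^+ n < 2 ^+ k.
  exists (Num.truncn (K * C ^+ n)).+1.
  apply: (lt_trans (truncnS_gt _)).
  by rewrite -natrX ltr_nat ltn_expl.
exists (n * k)%N => m nkm A fA HA.
have [fm fA0] := (fund_gt0 _ _ _ _ ophi iphi wh _ (it m _ fA), fund_gt0 _ _ _ _ ophi iphi wh _ fA).
rewrite ltr_pdivlMr//.
have km : (k <= m %/ n)%N by rewrite leq_divRL ?lt0n// mulnC.
have mE : m = (n * (m %/ n) + m %% n)%N by rewrite mulnC -divn_eq.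
have fq := it (n * (m %/ n))%N _ fA.
have fq0 := fund_gt0 _ _ _ _ ophi iphi wh _ fq.
have B1 : fund (iter m s' @^-1` A) <= C ^+ n * fund (iter (n * (m %/ n)) s' @^-1` A).
  rewrite {1}mE preimage_iterD.
  apply: (le_trans (fund_preimage_iter_le _ _ _ _ (m %% n) _ sK ms' bs bs' fq)).
  by rewrite ler_pM2r// ler_weXn2l// ltnW// ltn_mod lt0n.
have B2 := grow (m %/ n)%N _ fA HA.
have B3 : (2 : R) ^+ k <= 2 ^+ (m %/ n) by rewrite ler_weXn2l// ler1n.
have [K0|K0] := leP K 0.
  by apply: le_lt_trans fA0; rewrite mulr_le0_ge0// ltW.
apply: (@le_lt_trans _ _ (K * C ^+ n * fund (iter (n * (m %/ n)) s' @^-1` A))).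
  by rewrite -mulrA ler_pM2l.
apply: (lt_le_trans _ B2); rewrite ltr_pM2r//; exact: lt_le_trans B3.
Qed.

(** Some [l < 2] makes the modular of [g / l] at most 1, and [g] is at most twice [g / l] in
    absolute value, so one doubling suffices. *)
Lemma OLnorm_lt2 D g : 0 < D -> (forall x, 0 < x -> phi (2 * x) <= D * phi x) ->
  measurable_fun setT g -> (OLnorm mu phi h g < 2%:E)%E ->
  (Imod mu phi h g <= D%:E)%E.
Proof.
move=> D0 dbl mg /ereal_inf_lt[_ [l [l0 Il] <-]]; rewrite lte_fin => l2.
have ml : measurable_fun setT (fun x => g x / l) by exact: measurable_funM.
apply: (le_trans (Imod_doubling _ _ _ ophi wh _ _ (fun x => g x / l) D0 dbl mg ml _)).
  move=> x; rewrite normrM normfV (gtr0_norm l0) mulrA ler_pdivlMr//.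
  by rewrite mulrC ler_wpM2r// ltW.
by rewrite -[leRHS]mule1 lee_wpmul2l// lee_fin ltW.
Qed.

(** If the modular of [2 g] were at most 1, the norm of [g] would be at most 1/2. Writing [2 g] as
    [g / 2^-1] matches the form in [OLnorm]. *)
Lemma Imod_sphere_gt D g : 0 < D -> (forall x, 0 < x -> phi (2 * x) <= D * phi x) ->
  measurable_fun setT g -> OLnorm mu phi h g = 1%E ->
  (1 < D%:E * Imod mu phi h g)%E.
Proof.
move=> D0 dbl mg g1.
have ml : measurable_fun setT (fun x => g x / 2^-1) by exact: measurable_funM.
apply: lt_le_trans (Imod_doubling _ _ _ ophi wh _ (fun x => g x / 2^-1) g D0 dbl ml mg _); last first.
  by move=> x; rewrite invrK normrM mulrC ger0_norm.
rewrite ltNge; apply/negP => Ig.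
have : (OLnorm mu phi h g <= (2^-1)%:E)%E.
  by apply: ereal_inf_lbound; exists 2^-1 => //; split => //; rewrite invr_gt0.
by rewrite g1 lee_fin; lra.
Qed.

(** Superlevel sets of [g \o f1] and [g \o f2] are preimages of those of [g], so [Wext_sum_growth]
    applies under the layer cake integral. *)
Lemma Imod_composition_growth K g (f1 f2 : X -> X) : sigma_finite setT mu -> 1 <= K ->
  measurable_fun setT g -> measurable_fun setT f1 -> measurable_fun setT f2 ->
  (forall A, finite_pos mu A ->
    finite_pos mu (f1 @^-1` A) /\ finite_pos mu (f2 @^-1` A)) ->
  (forall A, finite_pos mu A ->
    K < fund A / fund (f1 @^-1` A) \/ K < fund A / fund (f2 @^-1` A)) ->
  (K%:E * Imod mu phi h g <= Imod mu phi h (g \o f1) + Imod mu phi h (g \o f2))%E.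
Proof.
move=> sf K1 mg m1 m2 fp grow.
have mg1 : measurable_fun setT (g \o f1) by exact: measurableT_comp.
have mg2 : measurable_fun setT (g \o f2) by exact: measurableT_comp.
have W0 g' u : measurable_fun setT g' -> (0 <= Wext h (distrib mu g' u))%E.
  by move=> mg'; apply: (Wext_ge0 _ _ wh); exact: distrib_leT.
have mW g' := measurable_Wext_distrib _ _ _ _ ophi iphi wh g'.
rewrite !(Imod_layer_cake _ _ _ _ ophi iphi wh)// -ge0_integralD//; last 4 first.
- by move=> u _; exact: W0.
- exact: mW.
- by move=> u _; exact: W0.
- exact: mW.
have K0 : 0 <= K by exact: le_trans K1.
rewrite -ge0_integralZl_EFin//; last 2 first.
- by move=> u _; exact: W0.
- exact: mW.
apply: ge0_le_integral => //.
- by move=> u _; rewrite mule_ge0// W0.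
- by apply: measurable_funeM; exact: mW.
- by apply: emeasurable_funD; exact: mW.
move=> u _.
apply: (Wext_sum_growth _ _ _ _ ophi iphi wh _ f1 f2 sf K1 m1 m2 fp grow).
exact: measurable_superlevel.
Qed.

End dynamics.

(** * Uniform expansiveness and uniform growth of the fundamental quotients *)

Theorem mainTheorem3 (R : realType) (d : measure_display) (X : measurableType d)
  (mu : {measure set X -> \bar R}) (phi phi_inv h : R -> R) (tau tau' : X -> X)
  (M M' : R) :
  orlicz_function phi -> is_orlicz_inverse phi phi_inv -> Delta2 phi ->
  weight (mu setT) h ->
  sigma_finite setT mu ->
  cancel tau tau' -> cancel tau' tau ->
  measurable_fun setT tau -> measurable_fun setT tau' ->
  0 < M -> (forall A, measurable A -> (mu (tau @^-1` A) <= M%:E * mu A)%E) ->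
  0 < M' -> (forall A, measurable A -> (mu (tau @` A) <= M'%:E * mu A)%E) ->
  (exists K : R, forall g, inOL mu phi h g ->
      inOL mu phi h (g \o tau) /\
      (OLnorm mu phi h (g \o tau) <= K%:E * OLnorm mu phi h g)%E) ->
  uniformly_expansive_comp mu phi h tau tau' <->
  exists AB AC : set (set X),
    AB `|` AC = [set A | measurable A /\ (0 < mu A < +oo)%E] /\
    (forall K : R, exists N : nat, forall n : nat, (N <= n)%N -> forall A, AB A ->
       K < fundOL mu phi_inv h A / fundOL mu phi_inv h (iter n tau @` A)) /\
    (forall K : R, exists N : nat, forall n : nat, (N <= n)%N -> forall A, AC A ->
       K < fundOL mu phi_inv h A / fundOL mu phi_inv h (iter n tau' @` A)).
Proof.
move=> ophi iphi [D [D0 dbl]] wh sf tK t'K mt mt' _ bt _ imt' _.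
have bt' : pullback_bounded mu tau' M'.
  move=> A mA; rewrite -[tau' @^-1` A](image_iter tau tau' 1)//.
  exact: imt'.
have imt n A : iter n tau @` A = iter n tau' @^-1` A by exact: image_iter.
have imt1 n A : iter n tau' @` A = iter n tau @^-1` A by exact: image_iter.
have fpt' n A := finite_pos_iter mu _ _ _ _ n A tK mt' bt bt'.
have fpt n A := finite_pos_iter mu _ _ _ _ n A t'K mt bt' bt.
have fgt0 A := fund_gt0 _ _ _ _ ophi iphi wh A.
split.
- move=> [n ue].
  have dich A : finite_pos mu A ->
      2 * fundOL mu phi_inv h (iter n tau' @^-1` A) <= fundOL mu phi_inv h A \/
      2 * fundOL mu phi_inv h (iter n tau @^-1` A) <= fundOL mu phi_inv h A.
    move=> fA; have a0 := fgt0 _ fA.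
    (* Scaled by [a], the indicator of [A] has norm 1, and its compositions have as norms the
       quotients of [fundOL]. *)
    set a := fundOL mu phi_inv h A in a0 *.
    have mA : measurable A by case: fA.
    pose g x : R := a * \1_A x.
    have mg : measurable_fun setT g.
      by apply: measurable_funM => //; exact: measurable_indic.
    have ig : inOL mu phi h g.
      split => //; exists 1; split => //.
      rewrite (_ : (fun x => 1 * g x)%R = g); last by apply/funext => x; rewrite mul1r.
      have [w w0 [wE _]] := finite_pos_Wext _ phi_inv _ wh _ fA.
      by rewrite (Imod_indic _ _ _ _ ophi iphi wh)// wE -EFinM ltry.
    have ng : OLnorm mu phi h g = 1%E.
      by rewrite (OLnorm_indic _ _ _ _ ophi iphi wh)// divff// gt_eqF.
    have norm s k : finite_pos mu (iter k s @^-1` A) ->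
        OLnorm mu phi h (g \o iter k s) = (a / fundOL mu phi_inv h (iter k s @^-1` A))%:E.
      by move=> fs; rewrite -(OLnorm_indic _ _ _ _ ophi iphi wh).
    have := ue g ig ng; rewrite (norm _ _ (fpt n _ fA)) (norm _ _ (fpt' n _ fA)) !lee_fin.
    by rewrite !ler_pdivlMr ?fgt0//; [case; [right|left]|exact: fpt'|exact: fpt].
  (* [P s] collects the sets at which [fundOL] is halved along preimages under [iter n s]. Images
     under [tau] are preimages under [tau'], so [P tau'] serves as [AB]. *)
  pose P s := [set A | finite_pos mu A /\
      2 * fundOL mu phi_inv h (iter n s @^-1` A) <= fundOL mu phi_inv h A].
  exists (P tau'), (P tau); split; [|split] => [|K|K].
  + apply/seteqP; split => [A [[]|[]]//|A fA].
    by have [H|H] := dich _ fA; [left|right].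
  + have [N NP] := fund_uniform_growth _ _ _ _ ophi iphi wh _ _ _ _ n tK t'K mt mt' bt bt' dich K.
    by exists N => m Nm A [fA HA]; rewrite imt; exact: NP.
  + have dich' A (fA : finite_pos mu A) := iffLR (or_comm _ _) (dich A fA).
    have [N NP] := fund_uniform_growth _ _ _ _ ophi iphi wh _ _ _ _ n t'K tK mt' mt bt' bt dich' K.
    by exists N => m Nm A [fA HA]; rewrite imt1; exact: NP.
- move=> [AB [AC [ABC [HB HC]]]].
  (* With [I] the modular of [g], the bounds [1 < D I] and [K I <= 2 D] would force [K < 2 D^2]; the
     choice also ensures [1 <= K]. *)
  pose K := 2 * D ^+ 2 + 1.
  have K1 : 1 <= K by rewrite /K lerDr mulr_ge0// sqr_ge0.
  have [N1 HN1] := HB K; have [N2 HN2] := HC K.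
  exists (maxn N1 N2) => g [mg _] g1; set n := maxn N1 N2.
  have [|lt1] := leP 2%:E (OLnorm mu phi h (g \o iter n tau)); first by left.
  have [|lt2] := leP 2%:E (OLnorm mu phi h (g \o iter n tau')); first by right.
  have mi (s : X -> X) : measurable_fun setT s -> measurable_fun setT (iter n s).
    exact: measurable_fun_iter.
  have I1 := OLnorm_lt2 _ _ _ ophi wh _ _ D0 dbl (measurableT_comp mg (mi _ mt)) lt1.
  have I2 := OLnorm_lt2 _ _ _ ophi wh _ _ D0 dbl (measurableT_comp mg (mi _ mt')) lt2.
  have Ig := Imod_sphere_gt _ _ _ ophi wh _ _ D0 dbl mg g1.
  have IK : (K%:E * Imod mu phi h g <= (D + D)%:E)%E.
    rewrite EFinD; apply: le_trans (leeD I1 I2).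
    apply: (Imod_composition_growth _ _ _ _ ophi iphi wh) => //; [exact: mi|exact: mi| |].
      by move=> A fA; split; [exact: fpt|exact: fpt'].
    move=> A fA; have : (AB `|` AC) A by rewrite ABC.
    case=> [/(HN1 n (leq_maxl _ _))|/(HN2 n (leq_maxr _ _))].
      by rewrite imt; right.
    by rewrite imt1; left.
  have I0 := Imod_ge0 mu _ _ ophi wh g.
  (* A finite modular contradicts the choice of [K], an infinite one the upper bound [IK]. *)
  exfalso; move: Ig IK I0; case: (Imod mu phi h g) => [i| |]//.
    rewrite -!EFinM lte_fin !lee_fin /K expr2 => Ig IK i0; nra.
  by move=> _; rewrite gt0_muley ?lte_fin// (lt_le_trans ltr01).
Qed.
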